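(* Let $N\in\mathbb{N}$ and $\chi=\{0,\dots,N-1\}$ with the operation $x\oplus y=(x+y)\,\%\,N$. For any infinitely divisible random variable $\xi$ taking values in $\chi$ there exist $a\in\chi$, a divisor $M$ of $N$, a number $\lambda\ge 0$, and a random variable $X$ taking values in $\chi$ such that $$\xi \stackrel{d}{=} a\oplus (M\cdot U)\oplus\bigoplus_{k=1}^{\mathcal{N}}X_k,$$ where $U$ has the uniform distribution on the set $[0:\tfrac{N}{M}]$, $\{X_k\}_{k\in\mathbb{N}}$ are independent copies of $X$, $\mathcal{N}$ has the Poisson distribution with intensity $\lambda$, and $U$, $\mathcal{N}$, $\{X_k\}_{k\in\mathbb{N}}$ are independent.
   Context: Notation: for a positive integer $K$, $[0:K]=\{0,1,\dots,K-1\}$; $\%\,N$ denotes the remainder of division by $N$; $\stackrel{d}{=}$ denotes equality in distribution. A random variable $\xi$ taking values in $\chi$ is called infinitely divisible if for every $n\in\mathbb{N}$ there exist a random variable $X^{(n)}$ taking values in $\chi$ and an element $a_n\in\chi$ such that $\xi\stackrel{d}{=}X^{(n)}_1\oplus\cdots\oplus X^{(n)}_n\oplus a_n$, where $X^{(n)}_1,\dots,X^{(n)}_n$ are independent copies of $X^{(n)}$. An empty $\oplus$-sum equals $0$; Poisson intensity $\lambda=0$ means $\mathcal{N}=0$ almost surely. Divisors are positive divisors. *)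

(* Defs.v *)
(* MathComp-Analysis *)
From HB Require Import structures.
From mathcomp Require Import all_boot all_order all_algebra finmap.
From mathcomp Require Import all_classical all_reals all_analysis.

Set Implicit Arguments.
Unset Strict Implicit.
Unset Printing Implicit Defensive.

Import Order.TTheory GRing.Theory Num.Theory.

Local Open Scope classical_set_scope.
Local Open Scope ring_scope.

(* The cyclic group chi = {0, ..., N - 1}, for N = n.+1, is 'I_n.+1 with its
   library zmodType structure: x + y is Zp_add x y = inZp (x + y), i.e.
   (x + y) %% N. *)
HB.instance Definition _ (n : nat) := isPointed.Build 'I_n.+1 ord0.

HB.instance Definition _ (n : nat) :=
  @isMeasurable.Build default_measure_display 'I_n.+1
    discrete_measurable discrete_measurable0
    discrete_measurableC discrete_measurableU.

(* X and Y may live on different probability spaces. They are plain functions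
   so that expressions such as fun w => a + X w can be used directly; it is
   meant for measurable X and Y. *)
Definition eq_in_distribution (R : realType) (d d1 d2 : measure_display)
    (E : measurableType d) (T1 : measurableType d1) (T2 : measurableType d2)
    (P : probability T1 R) (X : T1 -> E) (Q : probability T2 R) (Y : T2 -> E)
    : Prop :=
  forall A : set E, measurable A -> pushforward P X A = pushforward Q Y A.

(* For a family of random variables X i, take F i := g_sigma_algebra_preimage
   (X i), the sigma-algebra generated by X i; this allows the X i to have
   different codomains. *)
Definition mutually_independent (R : realType) (d : measure_display)
    (T : measurableType d) (P : probability T R) (I : choiceType)
    (F : I -> set (set T)) : Prop :=
  forall (J : {fset I}) (E : I -> set T),
    (forall i, i \in J -> F i (E i)) ->
    P (\bigcap_(i in [set` J]) E i) = (\prod_(i <- J) P (E i))%E.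

Definition uniformly_distributed (R : realType) (d : measure_display)
    (T : measurableType d) (P : probability T R) (K : nat) (U : T -> nat)
    : Prop :=
  forall u : nat,
    pushforward P U [set u] = (if (u < K)%N then K%:R^-1 else 0 : R)%:E.

(* The last argument of poisson_prob (here 0) is a dummy: poisson_prob lambda k
   is the Poisson law of intensity lambda for any k. For lambda = 0 it is the
   Dirac mass at 0. *)
Definition poisson_distributed (R : realType) (d : measure_display)
    (T : measurableType d) (P : probability T R) (lambda : R) (V : T -> nat)
    : Prop :=
  forall A : set nat, pushforward P V A = poisson_prob lambda 0 A.

Definition infinitely_divisible (R : realType) (n : nat) (d : measure_display)
    (T : measurableType d) (P : probability T R) (xi : {RV P >-> 'I_n.+1})
    : Prop :=
  forall m : nat, (0 < m)%N ->
  exists (d' : measure_display) (T' : measurableType d') (Q : probability T' R)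
    (X : {RV Q >-> 'I_n.+1}) (Xs : 'I_m -> {RV Q >-> 'I_n.+1}) (a : 'I_n.+1),
    [/\ forall i, eq_in_distribution Q (Xs i) Q X,
        mutually_independent Q (fun i => g_sigma_algebra_preimage (Xs i))
      & eq_in_distribution P xi Q (fun w => \sum_(i < m) Xs i w + a)].

(* The sigma-algebras generated by U, V and X_0, X_1, ..., as one family. *)
Definition joint_family (R : realType) (n : nat) (d : measure_display)
    (T : measurableType d) (Q : probability T R) (U V : {RV Q >-> nat})
    (Xs : nat -> {RV Q >-> 'I_n.+1}) (i : option (option nat))
    : set (set T) :=
  match i with
  | None => g_sigma_algebra_preimage U
  | Some None => g_sigma_algebra_preimage V
  | Some (Some k) => g_sigma_algebra_preimage (Xs k)
  end.

(* Main.v *)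
Require Import Defs.
From HB Require Import structures.
From mathcomp Require Import all_boot all_order all_algebra finmap.
From mathcomp Require Import all_classical all_reals all_analysis.
From mathcomp Require Import measurable_realfun.
From mathcomp Require Import ring lra.

Set Implicit Arguments.
Unset Strict Implicit.
Unset Printing Implicit Defensive.

Import Order.TTheory GRing.Theory Num.Theory.
Import numFieldNormedType.Exports.

Local Open Scope classical_set_scope.
Local Open Scope ring_scope.

(** Let [p] be the law of [xi]; write [N] for [n.+1] and [tau_h] for the
    translation by [h]. Infinite divisibility gives, for every [m > 0], a law
    [q_m] on the cyclic group and a point [a_m] such that [p] is the [m]-th
    convolution power of [q_m] translated by [a_m]. Moving an atom of mass at
    least [1/N] to the origin, one may assume [q_m 0 >= 1/N].

    The analytic heart is an energy estimate replacing Fourier analysis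
    ([energy_circulantX]). Convolving [u] with [q] decreases the squared l2 norm
    of [u] by at least [q 0 * q h * |u - tau_h u|^2] (a variance inequality),
    and [|u - tau_h u|] is itself nonincreasing along the convolution powers;
    telescoping gives [m * q_m 0 * q_m h * |p - tau_h p|^2 <= 1]. Let [H] be the
    subgroup of all [h] with [tau_h p = p]. Then [m * q_m h] is bounded in [m]
    for every [h] outside [H]. Along an ultrafilter finer than the
    neighbourhoods of infinity, [a_m] is constant, say equal to [a], and
    [m * q_m h] converges to some [nu h] for [h] outside [H] (put [nu = 0] on
    [H]).

    Since [p] is [H]-invariant, the mass [q_m] puts on [H] may be moved to the
    origin before averaging over [H]. Expanding the [m]-th power by the binomial
    theorem, keeping the first [K] terms and passing to the limit shows that [p]
    dominates the partial sums of the series for [delta_a] convolved with the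
    uniform law on [H] and with the compound Poisson law of intensity measure
    [nu] ([divisible_pmf_lower_bound]). The subgroup [H] consists of the
    multiples of a divisor [M] of [N].

    It remains to realise that compound Poisson law by independent [U], [V] and
    [X_0, X_1, ...]. The required infinite independent sequence lives on [0, 1)
    with Lebesgue measure ([independent_sequence]): a law on the natural numbers
    cuts the interval into cells, the index of the cell of [x] has that law, and
    the relative position of [x] in its cell is again uniform and independent of
    the index, so the procedure can be iterated. Finally the law of
    [a + M U + sum_(k < V) X_k] is pointwise below [p]; both have total mass 1,
    hence they are equal ([eq_probability_of_le]). No estimate of the discarded
    binomial terms is needed. *)

(** * Circulant matrices and convolution on the cyclic group *)

Section circulant.
Context {R : realType} {n : nat}.
Local Notation G := 'I_n.+1.
Implicit Types (f g : G -> R) (x y z h : G).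

(** The matrix of convolution by [f]. The circulant matrices form the group
    algebra of the cyclic group inside the ring of square matrices, which
    supplies powers and the binomial theorem; column [0] of a circulant matrix
    is the function itself. *)
Definition circulant f : 'M[R]_n.+1 := \matrix_(i, j) f (i - j).

(** Convolution by the Dirac mass at [h], that is, translation by [h]. *)
Definition shift_mx h : 'M[R]_n.+1 := circulant (fun x => (x == h)%:R).

Lemma circulant_mulE f g i j :
  (circulant f * circulant g) i j = \sum_h f h * g (i - j - h).
Proof.
rewrite mxE (reindex (fun h => i - h)); last first.
  by exists (fun h => i - h) => h _; rewrite opprB addrC subrK.
by apply: eq_bigr => h _; rewrite !mxE opprB addrCA subrr addr0 addrAC.
Qed.

Lemma circulant_mulC f g : circulant f * circulant g = circulant g * circulant f.
Proof.
apply/matrixP => i j; rewrite !circulant_mulE (reindex (fun h => i - j - h)).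
  by apply: eq_bigr => h _; rewrite mulrC opprB [_ + (_ - _)]addrC subrK.
by exists (fun h => i - j - h) => h _; rewrite opprB addrC subrK.
Qed.

Lemma circulantM f g :
  circulant f * circulant g = circulant (fun x => \sum_h f h * g (x - h)).
Proof. by apply/matrixP => i j; rewrite circulant_mulE mxE. Qed.

Lemma shift_mx0 : shift_mx 0 = 1.
Proof. by apply/matrixP => i j; rewrite !mxE subr_eq0. Qed.

Lemma shift_mx_circulant h f :
  shift_mx h * circulant f = circulant (fun x => f (x - h)).
Proof.
apply/matrixP => i j; rewrite circulant_mulE mxE (bigD1 h)//= eqxx mul1r.
by rewrite big1 ?addr0// => k /negPf ->; rewrite mul0r.
Qed.

Lemma shift_mxD h1 h2 : shift_mx (h1 + h2) = shift_mx h1 * shift_mx h2.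
Proof.
rewrite shift_mx_circulant; congr circulant; apply/funext => x.
by rewrite subr_eq [h2 + _]addrC.
Qed.

Lemma circulant_sum f : circulant f = \sum_h f h *: shift_mx h.
Proof.
apply/matrixP => i j; rewrite mxE summxE (bigD1 (i - j))//= !mxE eqxx mulr1.
by rewrite big1 ?addr0// => h hij; rewrite !mxE eq_sym (negPf hij) mulr0.
Qed.

(** Powers of a circulant matrix are circulant, hence determined by their
    column [0]. *)
Lemma circulantX_circulant f k :
  circulant f ^+ k = circulant (fun x => (circulant f ^+ k) x 0).
Proof.
elim: k => [|k IHk].
  by apply/matrixP => i j; rewrite !mxE subr_eq0.
rewrite exprS IHk circulantM; congr circulant; apply/funext => x.
by rewrite mxE subr0.
Qed.

Lemma circulantXSE f k x :
  (circulant f ^+ k.+1) x 0 = \sum_h f h * (circulant f ^+ k) (x - h) 0.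
Proof.
by rewrite exprS {1}circulantX_circulant circulant_mulE subr0.
Qed.

(** Column [0] of the [k]-th power is the law of a sum of [k] independent
    variables with law [f]. *)
Lemma circulantXE f k x : (circulant f ^+ k) x 0 =
  \sum_(s : {ffun 'I_k -> G} | \sum_i s i == x) \prod_i f (s i).
Proof.
have -> : circulant f ^+ k = \prod_(i < k) \sum_h f h *: shift_mx h.
  by rewrite prodr_const card_ord -circulant_sum.
rewrite bigA_distr_bigA summxE [RHS]big_mkcond; apply: eq_bigr => s _.
rewrite scaler_prod -(big_morph shift_mx shift_mxD shift_mx0) !mxE subr0 eq_sym.
by case: eqP => _; rewrite ?mulr1 ?mulr0.
Qed.

Lemma circulantX_ge0 f k i j : (forall x, 0 <= f x) -> 0 <= (circulant f ^+ k) i j.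
Proof.
move=> f0; rewrite circulantX_circulant mxE circulantXE.
by apply: sumr_ge0 => s _; apply: prodr_ge0 => ? _.
Qed.

End circulant.

(** * The energy estimate *)

Section energy.
Context {R : realType} {n : nat}.
Local Notation G := 'I_n.+1.
Implicit Types (f u q : G -> R) (x y z h : G).

(** A variance is bounded below by the contribution of one pair of atoms. *)
Lemma weighted_variance (I : finType) (w x : I -> R) (a b : I) :
  (forall i, 0 <= w i) -> \sum_i w i = 1 ->
  w a * w b * (x a - x b) ^+ 2 <= \sum_i w i * x i ^+ 2 - (\sum_i w i * x i) ^+ 2.
Proof.
move=> w0 w1; set m := \sum_i w i * x i.
have -> : \sum_i w i * x i ^+ 2 - m ^+ 2 = \sum_i w i * (x i - m) ^+ 2.
  transitivity (\sum_i (w i * x i ^+ 2 - 2 * m * (w i * x i) + m ^+ 2 * w i)).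
    by rewrite big_split sumrB -!mulr_sumr -/m w1 /=; ring.
  by apply: eq_bigr => i _; ring.
have [->|ab] := eqVneq a b.
  by rewrite subrr expr0n mulr0; apply: sumr_ge0 => i _; rewrite mulr_ge0 ?sqr_ge0.
rewrite (bigD1 a)//= (bigD1 b) 1?eq_sym//= addrA.
have wab : w a + w b <= 1.
  rewrite -w1 (bigD1 a)//= (bigD1 b) 1?eq_sym//= addrA lerDl.
  exact: sumr_ge0.
apply: (@le_trans _ _ (w a * (x a - m) ^+ 2 + w b * (x b - m) ^+ 2)); last first.
  by rewrite lerDl; apply: sumr_ge0 => i _; rewrite mulr_ge0 ?sqr_ge0.
have := w0 a; have := w0 b; move: wab.
move: (w a) (w b) (x a) (x b) => s t y z st t0 s0.
rewrite -subr_ge0.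
(* With [r = 1 - s - t] the difference is [s r A^2 + t r B^2 + (s A + t B)^2]. *)
pose A := y - m; pose B := z - m.
have -> : s * (y - m) ^+ 2 + t * (z - m) ^+ 2 - s * t * (y - z) ^+ 2 =
  s * (1 - s - t) * A ^+ 2 + t * (1 - s - t) * B ^+ 2 + (s * A + t * B) ^+ 2.
  by rewrite /A /B; ring.
have d0 : 0 <= 1 - s - t by lra.
by rewrite !addr_ge0 ?sqr_ge0// mulr_ge0 ?sqr_ge0// mulr_ge0.
Qed.

(** The squared l2 norm. *)
Definition energy u : R := \sum_x u x ^+ 2.

Lemma energy_shift u h : energy (fun x => u (x - h)) = energy u.
Proof.
rewrite /energy [RHS](reindex (fun x => x - h))//.
by exists (fun x => x + h) => x _; rewrite ?subrK ?addrK.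
Qed.

(** Convolution with a probability vector [q] decreases the energy by an amount
    controlled by any two atoms [0] and [h] of [q]. *)
Lemma energy_conv q u h : (forall x, 0 <= q x) -> \sum_x q x = 1 ->
  energy (fun x => \sum_y q y * u (x - y)) +
    q 0 * q h * energy (fun x => u x - u (x - h)) <= energy u.
Proof.
move=> q0 q1.
have -> : energy u = \sum_x \sum_y q y * u (x - y) ^+ 2.
  rewrite exchange_big/= -[LHS]mul1r -q1 mulr_suml; apply: eq_bigr => y _.
  by rewrite -mulr_sumr -(energy_shift u y).
rewrite -lerBrDl /energy -sumrB mulr_sumr; apply: ler_sum => x _.
by have := weighted_variance (fun y => u (x - y)) 0 h q0 q1; rewrite subr0.
Qed.

Lemma energy_conv_le q u : (forall x, 0 <= q x) -> \sum_x q x = 1 ->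
  energy (fun x => \sum_y q y * u (x - y)) <= energy u.
Proof.
move=> q0 q1; apply: le_trans (energy_conv u 0 q0 q1); rewrite lerDl.
by rewrite mulr_ge0 ?mulr_ge0// sumr_ge0// => x _; rewrite sqr_ge0.
Qed.

(** If [q] has mass at [0] and at [h], then its [m]-th convolution power is
    almost invariant under translation by [h]: the energy of the difference is
    at most [1 / (m * q 0 * q h)]. *)
Lemma energy_circulantX q h m : (forall x, 0 <= q x) -> \sum_x q x = 1 ->
  m%:R * (q 0 * q h * energy (fun x =>
    (circulant q ^+ m) x 0 - (circulant q ^+ m) (x - h) 0)) <= 1.
Proof.
move=> q0 q1; pose u j x := (circulant q ^+ j) x 0.
have uS j : u j.+1 = fun x => \sum_y q y * u j (x - y).
  by apply/funext => x; rewrite /u circulantXSE.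
pose D j := energy (fun x => u j x - u j (x - h)); rewrite -/(D m).
have DS j : D j.+1 <= D j.
  rewrite /D uS; apply: le_trans (energy_conv_le _ q0 q1).
  rewrite le_eqVlt; apply/orP; left; apply/eqP; congr energy; apply/funext => x.
  rewrite -sumrB; apply: eq_bigr => y _; rewrite -mulrBr.
  by rewrite addrAC.
have D_ge0 j : 0 <= D j by apply: sumr_ge0 => x _; rewrite sqr_ge0.
(* The sum of the [m] successive energy losses, each at least
   [q 0 * q h * D m] because [D] is nonincreasing, is at most the initial
   energy 1. *)
suff : energy (u m) + m%:R * (q 0 * q h * D m) <= 1.
  by apply: le_trans; rewrite lerDr; apply: sumr_ge0 => x _; rewrite sqr_ge0.
elim: m => [|m IHm].
  rewrite mul0r addr0 /energy (bigD1 0)//= big1 => [|x x0].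
    by rewrite /u expr0 mxE eqxx expr1n addr0.
  by rewrite /u expr0 mxE (negPf x0) expr0n.
apply: le_trans IHm; rewrite uS.
apply: le_trans (lerD (energy_conv (u m) h q0 q1) (lexx _)).
rewrite -addrA lerD2l -/(D m) -[m.+1]add1n natrD mulrDl mul1r lerD//.
  by rewrite ler_wpM2l// mulr_ge0.
by rewrite ler_wpM2l// ler_wpM2l// mulr_ge0.
Qed.

End energy.

(** * Subgroups of the cyclic group *)

Section subgroup.
Context {n : nat}.
Local Notation G := 'I_n.+1.

Lemma inZpD (i j : nat) : (inZp (i + j)%N : G) = inZp i + inZp j.
Proof. by apply: val_inj; rewrite /= modnDm. Qed.

Lemma inZp_val (x : G) : inZp x = x.
Proof. by apply: val_inj; rewrite /= modn_small. Qed.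

(** A subgroup of the integers modulo [n.+1] consists of the multiples of a
    divisor of [n.+1], namely its least positive representative. *)
Lemma subgroup_generator (H : pred G) :
  H 0 -> (forall x y, H x -> H y -> H (x + y)) -> (forall x, H x -> H (- x)) ->
  exists M, [/\ (0 < M)%N, (M %| n.+1)%N & forall k, H (inZp k) = (M %| k)%N].
Proof.
move=> H0 HD HN.
have HM k l : H (inZp k) -> H (inZp (l * k)%N).
  move=> Hk; elim: l => [|l IHl]; last by rewrite mulSn inZpD HD.
  by rewrite mul0n (_ : inZp 0 = 0)//; exact: val_inj.
have N0 : (inZp n.+1 : G) = 0 by apply: val_inj; rewrite /= modnn.
have exM : exists m, (0 < m)%N && H (inZp m) by exists n.+1; rewrite N0.
case: (ex_minnP exM) => M /andP[M0 HMM] Mmin.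
have Hdvd k : H (inZp k) = (M %| k)%N.
  apply/idP/idP => [Hk|/dvdnP[l ->]]; last exact: HM.
  rewrite /dvdn -leqn0 leqNgt; apply/negP => r0.
  have Hr : H (inZp (k %% M)%N).
    have -> : (inZp (k %% M)%N : G) = inZp k - inZp (k %/ M * M)%N.
      by rewrite [X in inZp X - _](divn_eq k M) inZpD addrAC subrr add0r.
    by apply: HD => //; apply: HN; apply: HM.
  by have := Mmin (k %% M)%N; rewrite r0 Hr => /(_ isT); rewrite leqNgt ltn_pmod.
by exists M; split=> //; rewrite -Hdvd N0.
Qed.

Lemma sum_subgroup (V : nmodType) (H : pred G) (M : nat) (F : G -> V) :
  (0 < M)%N -> (M %| n.+1)%N -> (forall k, H (inZp k) = (M %| k)%N) ->
  \sum_(h | H h) F h = \sum_(u < n.+1 %/ M) F (inZp (M * u)%N).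
Proof.
move=> M0 Mn HM.
have Mu (u : 'I_(n.+1 %/ M)) : (M * u < n.+1)%N.
  by rewrite mulnC -ltn_divRL.
rewrite (reindex (fun u : 'I_(n.+1 %/ M) => inZp (M * u)%N : G)); last first.
  have hM (h : G) : (h %/ M < n.+1 %/ M)%N.
    by rewrite ltn_divRL// (leq_ltn_trans (leq_trunc_div _ _)).
  exists (fun h => Ordinal (hM h)) => [u _|h].
    by apply: val_inj; rewrite /= modn_small// mulKn.
  rewrite inE -[X in H X]inZp_val HM => Mh; apply: val_inj => /=.
  by rewrite mulnC divnK// modn_small.
by apply: eq_bigl => u; rewrite HM dvdn_mulr.
Qed.

End subgroup.

(** * Lower bound from the binomial expansion *)

Section binomial_bound.
Context {R : realType} {n : nat}.
Local Notation G := 'I_n.+1.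
Variables (H : pred G).
Hypotheses (HD : forall x y, H x -> H y -> H (x + y))
  (HN : forall x, H x -> H (- x)).
Implicit Types (f q : G -> R).

(** The sum of all translations by elements of [H]; up to normalisation,
    convolution by the uniform law on [H]. *)
Definition sum_shift_mx : 'M[R]_n.+1 := \sum_(h | H h) shift_mx h.

Lemma sum_shift_mx_circulant f x :
  (sum_shift_mx * circulant f) x 0 = \sum_(h | H h) f (x - h).
Proof.
rewrite mulr_suml summxE; apply: eq_bigr => h _.
by rewrite shift_mx_circulant mxE subr0.
Qed.

Lemma sum_shift_mx_absorb h : H h -> shift_mx h * sum_shift_mx = sum_shift_mx.
Proof.
move=> Hh; rewrite mulr_sumr /sum_shift_mx [RHS](reindex (fun x => h + x))/=.
  apply: eq_big => x; last by rewrite shift_mxD.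
  by apply/idP/idP => [|Hx]; [exact: HD|rewrite -(addKr h x) HD ?HN].
by exists (fun x => - h + x) => x _; rewrite ?addKr ?addNKr.
Qed.

(** The restriction of [q] to the complement of [H], extended by zero. *)
Definition restrict_out q : G -> R := fun x => if H x then 0 else q x.

(** After averaging over [H], the mass that [q] gives to [H] can be moved to the
    origin. *)
Lemma circulant_sum_shift_mx q : \sum_x q x = 1 ->
  circulant q * sum_shift_mx =
  ((1 - \sum_x restrict_out q x)%:M + circulant (restrict_out q)) * sum_shift_mx.
Proof.
move=> q1; rewrite (circulant_sum q) (bigID H)/= !mulrDl; congr (_ + _).
  have -> : 1 - \sum_x restrict_out q x = \sum_(x | H x) q x.
    apply/eqP; rewrite subr_eq -q1 (bigID H)/= [X in _ + X]big_mkcond/=.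
    by apply/eqP; congr (_ + _); apply: eq_bigr => x _; rewrite /restrict_out; case: (H x).
  rewrite -scalemx1 -scalerAl mul1r scaler_suml mulr_suml.
  by apply: eq_bigr => h Hh; rewrite -scalerAl sum_shift_mx_absorb.
congr (_ * _); rewrite circulant_sum big_mkcond/=; apply: eq_bigr => x _.
by rewrite /restrict_out; case: (H x); rewrite /= ?scale0r.
Qed.

(** Summed over the translations by [H], the [m]-th power of [q] dominates the
    first [K] terms of the binomial expansion of [((1 - s) delta_0 + w)^m],
    summed likewise, where [w] is the part of [q] outside [H] and [s] its mass:
    by [circulant_sum_shift_mx] the full expansion gives equality. *)
Lemma binomial_lower_bound q m K x : (forall x, 0 <= q x) -> \sum_x q x = 1 ->
  (K <= m.+1)%N ->
  \sum_(k < K) ('C(m, k)%:R * (1 - \sum_x restrict_out q x) ^+ (m - k) *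
     \sum_(h | H h) (circulant (restrict_out q) ^+ k) (x - h) 0)
  <= \sum_(h | H h) (circulant q ^+ m) (x - h) 0.
Proof.
move=> q0 q1 Km.
set w := restrict_out q; set s := \sum_x w x.
have w0 y : 0 <= w y by rewrite /w /restrict_out; case: ifP.
have s1 : 0 <= 1 - s.
  by rewrite subr_ge0 -q1; apply: ler_sum => y _; rewrite /w /restrict_out; case: ifP.
have sC (a : R) (A : 'M[R]_n.+1) : a%:M * A = A * a%:M := esym (scalar_mxC a A).
have CP f : sum_shift_mx * circulant f = circulant f * sum_shift_mx.
  by rewrite mulr_suml mulr_sumr; apply: eq_bigr => h _; rewrite circulant_mulC.
have -> : \sum_(h | H h) (circulant q ^+ m) (x - h) 0 =
    (((1 - s)%:M + circulant w) ^+ m * sum_shift_mx) x 0.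
  rewrite -(sum_shift_mx_circulant (fun y => (circulant q ^+ m) y 0)).
  rewrite CP -(circulantX_circulant q m).
  set B := (1 - s)%:M + circulant w.
  have BP : B * sum_shift_mx = sum_shift_mx * B.
    by rewrite mulrDl mulrDr CP sC.
  congr fun_of_matrix; elim: {Km} m => [|m IHm]; first by rewrite !expr0.
  rewrite !exprSr -!mulrA circulant_sum_shift_mx// -/w -/s -/B BP.
  by rewrite !mulrA IHm.
have cB : GRing.comm (1 - s)%:M (circulant w).
  exact: sC.
rewrite exprDn_comm// mulr_suml summxE.
pose W k : 'M[R]_n.+1 := (1 - s)%:M ^+ (m - k) * circulant w ^+ k *+ 'C(m, k).
have term k : (W k * sum_shift_mx) x 0 =
    'C(m, k)%:R * (1 - s) ^+ (m - k) * \sum_(h | H h) (circulant w ^+ k) (x - h) 0.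
  rewrite /W -(sum_shift_mx_circulant (fun x => (circulant w ^+ k) x 0)).
  rewrite -(circulantX_circulant w k).
  have -> : ((1 - s)%:M : 'M[R]_n.+1) ^+ (m - k) = ((1 - s) ^+ (m - k))%:M by rewrite rmorphXn.
  have -> : (((1 - s) ^+ (m - k))%:M : 'M[R]_n.+1) * circulant w ^+ k
      = (1 - s) ^+ (m - k) *: circulant w ^+ k by exact: mul_scalar_mx.
  have -> : sum_shift_mx * circulant w ^+ k = circulant w ^+ k * sum_shift_mx.
    by rewrite (circulantX_circulant w k) CP.
  have sl (c : R) (A B : 'M[R]_n.+1) : c *: A * B = c *: (A * B).
    exact/esym/scalemxAl.
  by rewrite -scaler_nat scalerA sl mxE.
under eq_bigr do rewrite -term.
rewrite -[leRHS](big_mkord xpredT (fun k => (W k * sum_shift_mx) x 0)).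
rewrite -(big_mkord xpredT (fun k => (W k * sum_shift_mx) x 0)).
rewrite (big_cat_nat _ Km)//= lerDl; apply: sumr_ge0 => k _.
rewrite term !mulr_ge0 ?exprn_ge0// sumr_ge0// => h _.
exact: circulantX_ge0.
Qed.

End binomial_bound.

(** * Limits along an ultrafilter *)

Section ultrafilter.

Lemma ultra_cvg_bounded {R : realType} {T : Type} (F : set_system T)
    (f : T -> R) (C : R) :
  UltraFilter F -> (\forall t \near F, 0 <= f t <= C) ->
  exists l : R, f t @[t --> F] --> l.
Proof.
move=> FU fC.
have PF : ProperFilter (f t @[t --> F]) by exact: fmap_proper_filter.
have [|l [_ fl]] := segment_compact (a := 0) (b := C) PF.
  by apply: filterS fC => t; rewrite /= in_itv.
exists l => A lA; case: (in_ultra_setVsetC (f @^-1` A) FU) => // FnA.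
by have [x []] := fl (~` A) A FnA lA.
Qed.

Lemma ultra_eventually_constant {I : finType} {T : Type} (F : set_system T)
    (f : T -> I) : UltraFilter F -> exists i, \forall t \near F, f t = i.
Proof.
move=> FU; apply: contrapT => /forallNP nf.
have : \forall t \near F, forall i, f t <> i.
  apply: filter_forall => i.
  by case: (in_ultra_setVsetC [set t | f t = i] FU) => // /nf.
by move=> /filter_ex[t /(_ (f t))].
Qed.

End ultrafilter.

Section limits.
Context {R : realType} {n : nat}.
Local Notation G := 'I_n.+1.

Lemma cvgr_sum {T : Type} (F : set_system T) {FF : Filter F} (I : Type)
    (r : seq I) (P : pred I) (f : I -> T -> R) (l : I -> R) :
  (forall i, P i -> f i t @[t --> F] --> (l i : R)) ->
  \sum_(i <- r | P i) f i t @[t --> F] --> \sum_(i <- r | P i) l i.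
Proof.
move=> fl; apply: cvg_big => //.
by move=> [x y]; exact: add_continuous.
Qed.

Lemma circulantX_cvg {T : Type} (F : set_system T) {FF : Filter F}
    (f : T -> G -> R) (l : G -> R) k x :
  (forall x, f t x @[t --> F] --> l x) ->
  (circulant (f t) ^+ k) x 0 @[t --> F] --> (circulant l ^+ k) x 0.
Proof.
move=> fl; elim: k x => [|k IHk] x; first by rewrite !expr0; exact: cvg_cst.
rewrite circulantXSE; under eq_fun do rewrite circulantXSE.
by apply: cvgr_sum => h _; apply: cvgM.
Qed.

(** With [N = m.+1], the binomial coefficient is
    [N (N - 1) ... (N - k + 1) / k!], and each of the [k] factors of its
    numerator is at least [N - k]. *)
Lemma bin_lower_bound (m k : nat) : (k <= m.+1)%N ->
  k`!%:R^-1 * (1 - k%:R / m.+1%:R) ^+ k <= 'C(m.+1, k)%:R / m.+1%:R ^+ k :> R.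
Proof.
move=> km.
have m0 : 0 < m.+1%:R :> R by rewrite ltr0n.
rewrite ler_pdivlMr ?exprn_gt0// -mulrA -exprMn mulrBl mul1r divfK ?gt_eqF//.
rewrite -natrB// mulrC ler_pdivrMr ?ltr0n ?fact_gt0// -natrX -natrM ler_nat.
rewrite bin_ffact ffact_prod -[X in (_ ^ X)%N]card_ord -prod_nat_const.
by apply: leq_prod => i _; rewrite leq_sub2l// ltnW.
Qed.

Lemma expR_div_le_onem (s : R) : s < 1 -> expR (- (s / (1 - s))) <= 1 - s.
Proof.
move=> s1; have s0 : 0 < 1 - s by rewrite subr_gt0.
rewrite expRN -[leRHS]invrK lef_pV2 ?posrE ?expR_gt0 ?invr_gt0//.
apply: le_trans (expR_ge1Dx _); rewrite le_eqVlt; apply/orP; left; apply/eqP.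
by field; rewrite gt_eqF.
Qed.

End limits.

(** * Divisible laws dominate a compound Poisson law *)

Section lower_bound.
Context {R : realType} {n : nat}.
Local Notation G := 'I_n.+1.
Implicit Types (p q : G -> R).

(** [p] is, for every [m > 0], a translate of the [m]-th convolution power of a
    probability vector. *)
Definition divisible_pmf p := forall m, (0 < m)%N ->
  exists (q : G -> R) (a : G), [/\ forall x, 0 <= q x, \sum_x q x = 1 &
    forall x, p x = (circulant q ^+ m) (x - a) 0].

Lemma circulantX_translate q b m x :
  (circulant q ^+ m) x 0 = (circulant (fun y => q (y + b)) ^+ m) (x - b *+ m) 0.
Proof.
have qE : circulant q = shift_mx b * circulant (fun y => q (y + b)).
  by rewrite shift_mx_circulant; congr circulant; apply/funext => y; rewrite subrK.
elim: m x => [|m IHm] x; first by rewrite !expr0 mulr0n subr0.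
rewrite !circulantXSE (reindex (fun y => y + b)).
  apply: eq_bigr => y _; rewrite IHm; congr (_ * fun_of_matrix _ _ _).
  by rewrite [RHS]addrAC mulrS !opprD !addrA.
by exists (fun y => y - b) => y _; rewrite ?addrK ?subrK.
Qed.

(** The convolution roots may be translated so that they give mass at least
    [1 / n.+1] to the origin. The index [m] stands for the [m.+1]-th root. *)
Lemma divisible_pmf_centered p : divisible_pmf p -> forall m,
  exists qa : (G -> R) * G, [/\ forall x, 0 <= qa.1 x, \sum_x qa.1 x = 1,
    n.+1%:R^-1 <= qa.1 0 &
    forall x, p x = (circulant qa.1 ^+ m.+1) (x - qa.2) 0].
Proof.
move=> dp m; have [//|q [a [q0 q1 pE]]] := dp m.+1 _.
have [b qb] : exists b, n.+1%:R^-1 <= q b.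
  apply: contrapT => /forallNP nq.
  have : \sum_x q x < \sum_(x : G) n.+1%:R^-1.
    apply: ltr_sum => [|b _]; last by rewrite ltNge; apply/negP/nq.
    by apply/hasP; exists 0 => //; rewrite mem_index_enum.
  by rewrite q1 sumr_const card_ord -[X in _ < X]mulr_natl divff ?pnatr_eq0// ltxx.
exists (fun x => q (x + b), a + b *+ m.+1); split=> /=.
- by move=> x; exact: q0.
- rewrite -q1 [RHS](reindex (fun y => y + b))//.
  by exists (fun y => y - b) => y _; rewrite ?addrK ?subrK.
- by rewrite add0r.
- by move=> x; rewrite pE (circulantX_translate q b) opprD addrA.
Qed.

(** The sum over [u] normalised by [n.+1 %/ M] is convolution by the uniform law
    on the multiples of [M]; the sum over [k] is a partial sum of the compound
    Poisson series with intensity measure [nu]. *)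
Theorem divisible_pmf_lower_bound p : divisible_pmf p ->
  exists (a : G) (M : nat) (nu : G -> R),
  [/\ (0 < M)%N, (M %| n.+1)%N, forall x, 0 <= nu x &
   forall K x, \sum_(k < K) expR (- \sum_y nu y) / k`!%:R *
     ((n.+1 %/ M)%:R^-1 * \sum_(u < n.+1 %/ M)
       (circulant nu ^+ k) (x - a - inZp (M * u)%N) 0) <= p x].
Proof.
move=> /divisible_pmf_centered/choice[qa qaP].
pose q m := (qa m).1; pose a m := (qa m).2.
have q_ge0 m x : 0 <= q m x by have [+ _ _ _] := qaP m; exact.
have q1 m : \sum_x q m x = 1 by have [_ + _ _] := qaP m.
have q_0 m : n.+1%:R^-1 <= q m 0 by have [_ _ + _] := qaP m.
have pE m x : p x = (circulant (q m) ^+ m.+1) (x - a m) 0.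
  by have [_ _ _ +] := qaP m; exact.
(* [H] is the subgroup of periods of [p]. *)
pose H (h : G) := [forall x, p (x + h) == p x].
have HP h : reflect (forall x, p (x + h) = p x) (H h).
  by apply: (iffP forallP) => Hh x; apply/eqP.
have H0 : H 0 by apply/HP => x; rewrite addr0.
have HD x y : H x -> H y -> H (x + y).
  by move=> /HP Hx /HP Hy; apply/HP => z; rewrite addrA Hy Hx.
have HN x : H x -> H (- x).
  by move=> /HP Hx; apply/HP => z; rewrite -[in RHS](subrK x z) Hx.
(* Outside [H] the quantity [E h] is positive, so [qE] bounds
   [m.+1 * q m h] uniformly in [m]. *)
pose E h := energy (fun x => p x - p (x - h)).
have E_ge0 h : 0 <= E h by apply: sumr_ge0 => x _; rewrite sqr_ge0.
have qE m h : m.+1%:R * q m h * E h <= n.+1%:R.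
  have := energy_circulantX h m.+1 (q_ge0 m) (q1 m).
  rewrite -(energy_shift _ (a m)).
  have -> : energy (fun x => (circulant (q m) ^+ m.+1) (x - a m) 0 -
      (circulant (q m) ^+ m.+1) (x - a m - h) 0) = E h.
    congr energy; apply/funext => x; rewrite !(pE m).
    by rewrite [x - h - _]addrAC.
  move=> qE1; rewrite -[leRHS]mulr1 -ler_pdivrMl ?ltr0n//.
  apply: le_trans qE1; rewrite -!mulrA [leRHS]mulrCA ler_wpM2r//.
  by rewrite mulr_ge0// mulr_ge0.
have E_gt0 h : ~~ H h -> 0 < E h.
  move=> nHh; rewrite lt_neqAle E_ge0 andbT; apply: contra nHh.
  rewrite eq_sym psumr_eq0 => [/allP E0|x _]; last by rewrite sqr_ge0.
  apply/HP => x; have := E0 (x + h); rewrite mem_index_enum => /(_ isT).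
  by rewrite sqrf_eq0 addrK subr_eq0 => /eqP.
pose v m := restrict_out H (fun x => m.+1%:R * q m x).
have v_ge0 m x : 0 <= v m x.
  by rewrite /v /restrict_out; case: ifP => // _; rewrite mulr_ge0.
have vE m : circulant (restrict_out H (q m)) = m.+1%:R^-1 *: circulant (v m).
  apply/matrixP => i j; rewrite !mxE /v /restrict_out; case: ifP.
    by rewrite mulr0.
  by rewrite mulKf.
have sE m : \sum_x restrict_out H (q m) x = m.+1%:R^-1 * \sum_x v m x.
  rewrite mulr_sumr; apply: eq_bigr => x _; rewrite /v /restrict_out.
  by case: ifP; rewrite ?mulr0 ?mulKf.
(* Limits are taken along an ultrafilter [F] finer than the neighbourhoods of
   infinity: every bounded sequence converges along it. *)
have [F [FU ooF]] := ultraFilterLemma (eventually_filter : ProperFilter \oo).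
have vF x : exists l : R, v m x @[m --> F] --> l.
  case Hx : (H x).
    exists 0; rewrite /v /restrict_out Hx; exact: cvg_cst.
  apply: (ultra_cvg_bounded (C := n.+1%:R / E x)).
  apply: filterE => m; rewrite v_ge0/= /v /restrict_out Hx.
  by rewrite ler_pdivlMr// E_gt0// Hx.
have [nu nuF] := choice vF.
have [c cF] := ultra_eventually_constant a FU.
have [M [M0 Mn HM]] := subgroup_generator H0 HD HN.
exists c, M, nu; split=> //.
  by move=> x; apply: (cvgr_to_ge (nuF x)); apply: filterE => m; exact: v_ge0.
move=> K x.
pose d : R := (n.+1 %/ M)%:R.
have sumH (f : G -> R) : \sum_(h | H h) f h = \sum_(u < n.+1 %/ M) f (inZp (M * u)%N).
  exact: sum_subgroup.
have d0 : 0 < d by rewrite ltr0n divn_gt0// dvdn_leq.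
pose sigma m := \sum_y v m y.
pose S k m := \sum_(u < n.+1 %/ M) (circulant (v m) ^+ k) (x - c - inZp (M * u)%N) 0.
(* [g k m] bounds the [k]-th binomial term for the [m.+1]-th root from below and
   converges to the [k]-th compound Poisson term. *)
pose g k m : R := k`!%:R^-1 * (1 - k%:R / m.+1%:R) ^+ k *
  expR (- (sigma m / (1 - sigma m / m.+1%:R))) * (d^-1 * S k m).
have harm : m.+1%:R^-1 @[m --> F] --> (0 : R).
  by apply: cvg_trans (@cvg_harmonic R) => A /ooF.
have sigmaF : sigma m @[m --> F] --> \sum_y nu y by apply: cvgr_sum => y _.
have harmM (f : nat -> R) (l : R) : f m @[m --> F] --> l ->
    (1 - f m / m.+1%:R) @[m --> F] --> (1 : R).
  move=> fl; have := cvgB (cvg_cst (1 : R)) (cvgM fl harm).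
  by rewrite mulr0 subr0; apply.
have gF k : g k m @[m --> F] --> expR (- \sum_y nu y) / k`!%:R *
     (d^-1 * \sum_(u < n.+1 %/ M) (circulant nu ^+ k) (x - c - inZp (M * u)%N) 0).
  apply: cvgM; last first.
    by apply: cvgM; [exact: cvg_cst|apply: cvgr_sum => u _; exact: circulantX_cvg].
  rewrite [_ / _]mulrC; apply: cvgM.
    have := cvgM (cvg_cst (k`!%:R^-1 : R)) (cvg_comp _ _ (harmM _ _ (cvg_cst (k%:R : R)))
      (@exprn_continuous R k (1 : R))).
    by rewrite expr1n mulr1; apply.
  have := cvgM sigmaF (cvgV (oner_neq0 R) (harmM _ _ sigmaF)).
  rewrite invr1 mulr1 => sF.
  exact: (cvg_comp _ _ (cvgN (sF _ _)) (@continuous_expR R _)).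
have gsumF : \sum_(k < K) g k m @[m --> F] --> \sum_(k < K)
    expR (- \sum_y nu y) / k`!%:R * (d^-1 * \sum_(u < n.+1 %/ M)
      (circulant nu ^+ k) (x - c - inZp (M * u)%N) 0).
  by apply: cvgr_sum => k _; exact: gF.
apply: (cvgr_to_le gsumF).
have KF : \forall m \near F, (K <= m.+1)%N.
  by apply: ooF; exists K => // m /= Km; rewrite ltnW.
apply: filterS (filterI cF KF) => m [/= am Km].
have pxE : p x = d^-1 * \sum_(h | H h) (circulant (q m) ^+ m.+1) (x - c - h) 0.
  rewrite (eq_bigr (fun=> p x)); last first.
    move=> h Hh; rewrite -[x in RHS](subrK h x) (HP h Hh) (pE m) am.
    by rewrite [x - h - _]addrAC.
  rewrite sumH sumr_const card_ord -/d.
  by rewrite -[p x *+ _]mulr_natl -/d mulKf// gt_eqF.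
(* As [q m 0 > 0] and [0] lies in [H], the mass outside [H] is less than 1. *)
have s1 : sigma m / m.+1%:R < 1.
  rewrite mulrC -sE -(q1 m) (bigD1 0)//= [ltRHS](bigD1 0)//= {1}/restrict_out H0.
  rewrite ltr_leD//; first by apply: lt_le_trans (q_0 m); rewrite invr_gt0.
  by apply: ler_sum => y _; rewrite /restrict_out; case: ifP.
rewrite pxE; have di : 0 <= d^-1 by rewrite invr_ge0 ltW.
apply: le_trans (ler_wpM2l di
  (binomial_lower_bound HD HN (x - c) (q_ge0 m) (q1 m) (leqW Km))).
rewrite mulr_sumr; apply: ler_sum => k _.
rewrite sE vE [m.+1%:R^-1 * _]mulrC -/(sigma m).
under eq_bigr do rewrite exprZn mxE.
rewrite -mulr_sumr sumH -/(S k m) exprVn.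
have S0 : 0 <= d^-1 * S k m.
  rewrite mulr_ge0 ?invr_ge0 ?(ltW d0)//; apply: sumr_ge0 => u _.
  exact: circulantX_ge0.
set t := sigma m / m.+1%:R in s1 *.
have -> : d^-1 * ('C(m.+1, k)%:R * (1 - t) ^+ (m.+1 - k) * (m.+1%:R ^- k * S k m))
  = 'C(m.+1, k)%:R / m.+1%:R ^+ k * (1 - t) ^+ (m.+1 - k) * (d^-1 * S k m) by ring.
rewrite /g ler_wpM2r//; have km : (k <= m.+1)%N by rewrite (leq_trans _ Km)// ltnW.
rewrite -/t; have t1 : 0 < 1 - t by rewrite subr_gt0.
apply: ler_pM; rewrite ?expR_ge0//.
- rewrite mulr_ge0 ?invr_ge0// exprn_ge0// subr_ge0 ler_pdivrMr ?ltr0n//.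
  by rewrite mul1r ler_nat.
- exact: bin_lower_bound.
(* [(1 - t) ^ (m.+1 - k) >= (1 - t) ^ m.+1 >= exp (- m.+1 * t / (1 - t))]. *)
apply: (@le_trans _ _ ((1 - t) ^+ m.+1)); last first.
  have t_ge0 : 0 <= t by rewrite mulr_ge0 ?invr_ge0// sumr_ge0.
  rewrite -{1}(subnK km) exprD ler_piMr ?exprn_ge0 ?(ltW t1)//.
  by rewrite exprn_ile1 ?(ltW t1)// lerBlDr lerDl.
apply: le_trans (lerXn2r m.+1 _ _ (expR_div_le_onem s1)); rewrite ?nnegrE ?expR_ge0 ?(ltW t1)//.
rewrite -expRM_natl le_eqVlt; apply/orP; left; apply/eqP; congr expR.
by rewrite mulrN mulrA /t mulrCA divff ?mulr1 ?pnatr_eq0.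
Qed.

End lower_bound.

(** * Independent sequences of discrete random variables *)

Section unit_interval.
Context {R : realType}.

Let mI : measurable (`[0, 1[%classic : set (measurableTypeR R)).
Proof. exact: measurable_itv. Qed.

(** The uniform probability on [0, 1), as a measure on the whole real line. *)
Definition unit_prob : set (measurableTypeR R) -> \bar R :=
  mrestr (@lebesgue_measure R) mI.

HB.instance Definition _ := Measure.on unit_prob.

Let unit_probT : unit_prob setT = 1%E.
Proof.
by rewrite /unit_prob /mrestr setTI lebesgue_measure_itv/= lte_fin ltr01 oppr0 adde0.
Qed.

HB.instance Definition _ := Measure_isProbability.Build _ _ R unit_prob unit_probT.

Lemma lebesgue_measure_affine (c f : R) (B : set (measurableTypeR R)) :
  0 < f -> measurable B ->
  lebesgue_measure ((fun x : R => (x - c) / f) @^-1` B) = (f%:E * lebesgue_measure B)%E.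
Proof.
move=> f0 mB; pose phi (x : measurableTypeR R) : measurableTypeR R := (x - c) / f.
have mphi : measurable_fun setT phi.
  by apply: measurable_funM => //; exact: measurable_funB.
have fi0 : 0 <= f^-1 by rewrite invr_ge0 ltW.
have -> : lebesgue_measure B = pushforward (mscale (NngNum fi0) (@lebesgue_measure R)) phi B.
  apply: lebesgue_measure_unique => // _ [[a b]/= _ <-]; rewrite /pushforward /mscale /=.
  have -> : phi @^-1` `]a, b] = `](a * f + c), (b * f + c)]%classic.
    apply/seteqP; split => x /=; rewrite !in_itv/= /phi.
      by rewrite ltr_pdivlMr// ler_pdivrMr// ltrBrDr lerBlDr.
    by rewrite ltr_pdivlMr// ler_pdivrMr// ltrBrDr lerBlDr.
  rewrite !lebesgue_measure_itv/= !lte_fin ltrD2r ltr_pM2r//.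
  case: ifPn => _; last by rewrite mule0.
  rewrite -!EFinD -EFinM; congr EFin.
  by field; rewrite gt_eqF.
by rewrite /pushforward /mscale/= muleA -EFinM divff ?gt_eqF// mul1e.
Qed.

End unit_interval.

Section cell.
Context {R : realType}.
Implicit Types (F : nat -> R) (x : R).

(** A probability vector [F] on the natural numbers cuts [0, 1) into consecutive
    intervals of lengths [F 0], [F 1], ...; some of them may be empty. *)
Definition cell_itv F k : set (measurableTypeR R) :=
  [set` `[series F k, series F k.+1[].

(** The index of the interval containing [x]; the default value 0 is used when
    there is none, which does not happen on [0, 1). *)
Definition cell F (x : measurableTypeR R) : nat :=
  xget 0%N [set k | cell_itv F k x].

(** The relative position of [x] in its interval. *)
Definition rescale F (x : measurableTypeR R) : measurableTypeR R :=
  (x - series F (cell F x)) / F (cell F x).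

Lemma nondecreasing_series_pmf F : (forall k, 0 <= F k) -> nondecreasing_seq (series F).
Proof. by move=> F0; apply: nondecreasing_series => k _ _; exact: F0. Qed.

Lemma cell_itv_inj F x k l : (forall k, 0 <= F k) ->
  cell_itv F k x -> cell_itv F l x -> k = l.
Proof.
move=> F0; rewrite /cell_itv /= !in_itv/= => /andP[kx xk] /andP[lx xl].
apply/eqP; rewrite eqn_leq; apply/andP; split; rewrite leqNgt; apply/negP => kl.
  have := le_lt_trans (le_trans (nondecreasing_series_pmf F0 kl) kx) xl.
  by rewrite ltxx.
have := le_lt_trans (le_trans (nondecreasing_series_pmf F0 kl) lx) xk.
by rewrite ltxx.
Qed.

Lemma cellE F x k : (forall k, 0 <= F k) -> cell_itv F k x -> cell F x = k.
Proof.
move=> F0 kx; apply: (@cell_itv_inj F x) => //.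
by rewrite /cell; case: xgetP => [l _ //|/(_ k)].
Qed.

Lemma cell_itv_cell F x : (forall k, 0 <= F k) -> series F @ \oo --> (1 : R) ->
  x \in `[0, 1[ -> cell_itv F (cell F x) x.
Proof.
move=> F0 F1; rewrite in_itv/= => /andP[x0 x1].
have exk : exists k, x < series F k.
  have /filter_ex[k kx] : \forall k \near \oo, x < series F k.
    exact: (cvgr_gt (1 : R) F1).
  by exists k.
have [[|k] xk kmin] := ex_minnP exk.
  by move: xk; rewrite /series/= big_geq// ltNge x0.
have kx : cell_itv F k x.
  rewrite /cell_itv/= in_itv/= xk andbT leNgt; apply/negP => /kmin.
  by rewrite ltnn.
by rewrite (cellE F0 kx).
Qed.

Lemma measurable_cell F : (forall k, 0 <= F k) -> measurable_fun setT (cell F).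
Proof.
move=> F0.
have m1 k : measurable (cell F @^-1` [set k.+1]).
  have -> : cell F @^-1` [set k.+1] = cell_itv F k.+1; last exact: measurable_itv.
  apply/seteqP; split => [x/=|x]; last exact: cellE.
  by rewrite {1}/cell; case: xgetP => [l -> lx <-|].
move=> _ B _; rewrite setTI.
have -> : cell F @^-1` B = \bigcup_(k in B) cell F @^-1` [set k].
  by apply/seteqP; split => [x Bx|x [k Bk /= ->]//]; exists (cell F x).
apply: bigcup_measurable => -[_|k _]//.
have -> : cell F @^-1` [set 0%N] = ~` \bigcup_k (cell F @^-1` [set k.+1]).
  apply/seteqP; split => x /=; first by move=> x0 [k _] /=; rewrite x0.
  case Ex : (cell F x) => [//|k] nx; exfalso; apply: nx.
  by exists k.
by apply: measurableC; apply: bigcupT_measurable.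
Qed.

Lemma measurable_rescale F : (forall k, 0 <= F k) -> measurable_fun setT (rescale F).
Proof.
move=> F0; have mc := measurable_cell F0.
apply: measurable_funM; first apply: measurable_funB => //.
  exact: (measurableT_comp (f := series F)).
exact: (measurableT_comp (f := fun k => (F k)^-1)).
Qed.

(** The affine map of the [k]-th cell onto [0, 1) multiplies lengths by
    [1 / F k]. *)
Lemma unit_prob_cell_rescale1 F k (B : set (measurableTypeR R)) :
  (forall k, 0 <= F k) -> series F @ \oo --> (1 : R) -> measurable B ->
  unit_prob (cell F @^-1` [set k] `&` rescale F @^-1` B) = ((F k)%:E * unit_prob B)%E.
Proof.
move=> F0 F1 mB; have [Fk0|Fk0] := eqVneq (F k) 0.
  rewrite Fk0 mul0e /unit_prob /mrestr (_ : _ `&` _ = set0) ?measure0//.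
  apply/seteqP; split => // x [[/= xk _] x01]; have := cell_itv_cell F0 F1 x01.
  rewrite xk /cell_itv/= in_itv/= seriesSr Fk0 addr0 => /andP[kx].
  by rewrite ltNge kx.
have Fk : 0 < F k by rewrite lt_neqAle eq_sym Fk0 F0.
rewrite /unit_prob /mrestr.
rewrite -(lebesgue_measure_affine (series F k) Fk); last first.
  by apply: measurableI => //; exact: measurable_itv.
congr lebesgue_measure; apply/seteqP; split => x /=.
  move=> [[xk Bx] x01]; have := cell_itv_cell F0 F1 x01.
  rewrite xk /cell_itv/= in_itv/= seriesSr => /andP[kx xk1].
  split; first by move: Bx; rewrite /rescale xk.
  by rewrite in_itv/= divr_ge0 ?subr_ge0//= ltr_pdivrMr// mul1r ltrBlDl.
move=> [Bx]; rewrite in_itv/= pmulr_lge0 ?invr_gt0// subr_ge0 ltr_pdivrMr//.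
rewrite mul1r ltrBlDl -seriesSr => /andP[kx xk].
have cx : cell F x = k by apply: cellE => //; rewrite /cell_itv/= in_itv/= kx.
split; first by split => //; rewrite /rescale cx.
rewrite in_itv/=; apply/andP; split.
  by apply: le_trans kx; apply: sumr_ge0.
apply: lt_le_trans xk _; rewrite -(cvg_lim _ F1)//.
apply: nondecreasing_cvgn_le; first exact: nondecreasing_series_pmf.
by apply/cvg_ex; exists 1.
Qed.

(** Under the uniform probability, the relative position is independent of the
    cell and again uniform. *)
Lemma unit_prob_cell_rescale F (A : set nat) (B : set (measurableTypeR R)) :
  (forall k, 0 <= F k) -> series F @ \oo --> (1 : R) -> measurable B ->
  unit_prob (cell F @^-1` A `&` rescale F @^-1` B) =
  (unit_prob (cell F @^-1` A) * unit_prob B)%E.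
Proof.
move=> F0 F1; have mS C : measurable C -> measurable (rescale F @^-1` C).
  by move=> mC; rewrite -[X in measurable X]setTI; exact: measurable_rescale.
have mY C : measurable (cell F @^-1` C).
  by rewrite -[X in measurable X]setTI; exact: measurable_cell.
have split_cells C : measurable C ->
    unit_prob (cell F @^-1` A `&` rescale F @^-1` C) =
    (unit_prob C * \sum_(0 <= k <oo | k \in A) (F k)%:E)%E.
  move=> mC.
  have -> : cell F @^-1` A `&` rescale F @^-1` C =
      \bigcup_(k in A) (cell F @^-1` [set k] `&` rescale F @^-1` C).
    apply/seteqP; split => [x [Ax Cx]|x [k Ak [/= xk Cx]]]; last by rewrite /= xk.
    by exists (cell F x).
  rewrite measure_bigcup//=.
  - under eq_eseriesr do rewrite unit_prob_cell_rescale1// muleC.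
    have /fineK <- : unit_prob C \is a fin_num by exact: fin_num_measure.
    by rewrite nneseriesZl// => k _; rewrite lee_fin.
  - by move=> k _; apply: measurableI; [exact: mY|exact: mS].
  - by move=> i j _ _ [x [[/= <- _] [/= <- _]]].
move=> mB; rewrite split_cells//.
have := split_cells setT measurableT.
by rewrite preimage_setT setIT probability_setT mul1e => ->; rewrite muleC.
Qed.

End cell.

Section independent_sequence.
Context {R : realType}.
Implicit Types (F : nat -> nat -> R).

(** The position reached from [x] after [j] rescalings, the [i]-th of which uses
    the probability vector [F i]. *)
Fixpoint rescale_iter F j (x : measurableTypeR R) : measurableTypeR R :=
  if j is j'.+1 then rescale_iter (fun i => F i.+1) j' (rescale (F 0%N) x) else x.

(** The [j]-th digit of [x] in the mixed expansion given by the sequence of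
    probability vectors [F]. *)
Definition digit F j (x : measurableTypeR R) : nat := cell (F j) (rescale_iter F j x).

Lemma measurable_digit F j : (forall j k, 0 <= F j k) ->
  measurable_fun setT (digit F j).
Proof.
move=> F0; apply: measurableT_comp; first exact: measurable_cell.
elim: j F F0 => [|j IHj] F F0 /=; first exact: measurable_id.
apply: (measurableT_comp (IHj _ _)) => //; exact: measurable_rescale.
Qed.

Lemma unit_prob_digits F m (A : nat -> set nat) : (forall j k, 0 <= F j k) ->
  (forall j, series (F j) @ \oo --> (1 : R)) ->
  unit_prob (\bigcap_(j < m) digit F j @^-1` A j) =
  (\prod_(j < m) unit_prob (cell (F j) @^-1` A j))%E.
Proof.
elim: m F A => [|m IHm] F A F0 F1.
  by rewrite bigcap_mkord !big_ord0 probability_setT.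
rewrite big_ord_recl/=.
rewrite -(IHm (fun j => F j.+1) (fun j => A j.+1))//.
rewrite -unit_prob_cell_rescale//; last first.
  apply: bigcap_measurableType => j _.
  by rewrite -[X in measurable X]setTI; apply: measurable_digit.
congr unit_prob; rewrite preimage_bigcap; apply/seteqP; split => x /=.
  by move=> Ax; split => [|j jm]; [exact: (Ax 0%N)|exact: (Ax j.+1)].
by move=> [A0x Ax] [|j] jm; [exact: A0x|exact: (Ax j)].
Qed.

(** Independence is stated for initial segments; the choice [A j = setT] gives
    arbitrary finite subfamilies. *)
Theorem independent_sequence F : (forall j k, 0 <= F j k) ->
  (forall j, series (F j) @ \oo --> (1 : R)) ->
  exists (d : measure_display) (T : measurableType d) (Q : probability T R)
    (Y : nat -> {RV Q >-> nat}),
    (forall j k, Q (Y j @^-1` [set k]) = (F j k)%:E) /\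
    (forall m (A : nat -> set nat), Q (\bigcap_(j < m) Y j @^-1` A j) =
      (\prod_(j < m) Q (Y j @^-1` A j))%E).
Proof.
move=> F0 F1.
have mY j : measurable_fun setT (digit F j) by exact: measurable_digit.
pose Y j : {RV unit_prob >-> nat} :=
  HB.pack (digit F j) (isMeasurableFun.Build _ _ _ _ _ (mY j)).
have YE j (A : set nat) : unit_prob (Y j @^-1` A) = unit_prob (cell (F j) @^-1` A).
  have := unit_prob_digits j.+1 (fun i => if i == j then A else setT) F0 F1.
  rewrite big_ord_recr/= eqxx big1 ?mul1e => [<-|i _]; last first.
    by rewrite ltn_eqF// preimage_setT probability_setT.
  congr unit_prob; apply/seteqP; split => x /=.
    by move=> Ax i _; case: eqP => // ->.
  by move=> /(_ j (leqnn _)); rewrite eqxx.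
exists _, (measurableTypeR R), unit_prob, Y; split.
  move=> j k; transitivity (unit_prob (cell (F j) @^-1` [set k])); first exact: YE.
  have := @unit_prob_cell_rescale1 R (F j) k setT (F0 j) (F1 j) measurableT.
  by rewrite preimage_setT setIT probability_setT mule1.
move=> m A; rewrite (eq_bigr (fun j : 'I_m => unit_prob (cell (F j) @^-1` A j))).
  exact: unit_prob_digits.
by move=> j _; exact: YE.
Qed.

End independent_sequence.

(** * Laws of finite-valued and of integer-valued variables *)

Section finite_valued.
Context {R : realType} d (T : measurableType d) (Q : probability T R).

Lemma preimage_bigcup_fibers (I : Type) (Z : T -> I) (B : set I) :
  Z @^-1` B = \bigcup_(z in B) Z @^-1` [set z].
Proof. by apply/seteqP; split => [x Bx|x [z Bz /= ->]//]; exists (Z x). Qed.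

Lemma measurable_fin_preimage (I : finType) (Z : T -> I) (B : set I) :
  (forall z, measurable (Z @^-1` [set z])) -> measurable (Z @^-1` B).
Proof.
move=> mZ; rewrite preimage_bigcup_fibers.
by apply: fin_bigcup_measurable => //; exact: finite_finset.
Qed.

Lemma probability_fin_preimage (I : finType) (Z : T -> I) (D : set T) (B : pred I) :
  measurable D -> (forall z, measurable (Z @^-1` [set z])) ->
  Q (D `&` Z @^-1` [set z | B z]) = (\sum_(z | B z) Q (D `&` Z @^-1` [set z]))%E.
Proof.
move=> mD mZ; rewrite preimage_bigcup_fibers setI_bigcupr measure_fin_bigcup//.
- have -> : [set z | B z] = [set` [seq z <- index_enum I | B z]].
    by apply/seteqP; split => z/=; rewrite mem_filter mem_index_enum andbT.
  by rewrite -fsbig_seq ?filter_uniq ?index_enum_uniq// big_filter.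
- exact: finite_finset.
- by move=> i j _ _ [x [[_ /= <-] [_ /= <-]]].
- by move=> z _; exact: measurableI.
Qed.

Section sum.
Context {n : nat} (k : nat) (Z : 'I_k -> T -> 'I_n.+1).
Hypothesis mZ : forall i x, measurable (Z i @^-1` [set x]).

Let Zf (w : T) : {ffun 'I_k -> 'I_n.+1} := [ffun i => Z i w].

Let ZfE s : Zf @^-1` [set s] = \bigcap_i (Z i @^-1` [set s i]).
Proof.
apply/seteqP; split => [w /= <- i _|w Zw]; first by rewrite /= ffunE.
by apply/ffunP => i; rewrite ffunE; exact: Zw.
Qed.

Let mZf s : measurable (Zf @^-1` [set s]).
Proof.
by rewrite ZfE; apply: fin_bigcap_measurable => //; exact: finite_finset.
Qed.

Let sumE y : [set w | \sum_i Z i w = y] = Zf @^-1` [set s | \sum_i s i == y].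
Proof.
apply/seteqP; split => w /=; under [X in X == _]eq_bigr do rewrite ffunE.
  by move/eqP.
by move=> /eqP.
Qed.

Lemma measurable_sum_eq y : measurable [set w | \sum_i Z i w = y].
Proof. by rewrite sumE; exact: measurable_fin_preimage. Qed.

(** If, on the event [D], the variables [Z i] have the joint law of independent
    variables with law [q], up to the factor [c], then on [D] their sum has the
    law given by the convolution power of [q], up to [c]. *)
Lemma probability_sum_eq (D : set T) (c : R) (q : 'I_n.+1 -> R) :
  measurable D ->
  (forall s : {ffun 'I_k -> 'I_n.+1},
    Q (D `&` \bigcap_i (Z i @^-1` [set s i])) = (c * \prod_i q (s i))%:E) ->
  forall y, Q (D `&` [set w | \sum_i Z i w = y]) =
    (c * (circulant q ^+ k) y 0)%:E.
Proof.
move=> mD QD y; rewrite sumE probability_fin_preimage// circulantXE.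
rewrite mulr_sumr -sumEFin; apply: eq_bigr => s _.
by rewrite ZfE QD.
Qed.

End sum.

(** The events [A i] need only cover the space up to a null set. *)
Lemma probability_partition (I : finType) (A : I -> set T) (E : set T) :
  (forall i, measurable (A i)) -> trivIset setT A ->
  (\sum_i Q (A i) = 1)%E -> measurable E ->
  Q E = (\sum_i Q (E `&` A i))%E.
Proof.
move=> mA tA A1 mE.
have sumQ (D : I -> set T) : (forall i, measurable (D i)) -> trivIset setT D ->
    Q (\bigcup_i D i) = (\sum_i Q (D i))%E.
  move=> mD tD; rewrite measure_fin_bigcup//; last exact: finite_finset.
  have -> : [set: I] = [set` index_enum I].
    by apply/seteqP; split => z/=; rewrite mem_index_enum.
  by rewrite -fsbig_seq ?index_enum_uniq.
have mU : measurable (\bigcup_i A i).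
  by apply: fin_bigcup_measurable => //; exact: finite_finset.
have U0 : Q (~` \bigcup_i A i) = 0%E.
  by rewrite probability_setC// sumQ// A1 subee.
set U := \bigcup_i A i in mU U0 *.
have -> : Q E = (Q (E `\` U) + Q (E `&` U))%E by exact: measureDI.
have -> : Q (E `\` U) = 0%E.
  apply: (subset_measure0 _ _ _ U0); [exact: measurableD|exact: measurableC|].
  by rewrite setDE; exact: subIsetr.
rewrite add0e /U setI_bigcupr sumQ//; first by move=> i; exact: measurableI.
by move=> i j _ _ [x [[_ Aix] [_ Ajx]]]; apply: tA => //; exists x.
Qed.

End finite_valued.

Section nat_pmf.
Context {R : realType}.

Lemma eq_measure_nat (m1 m2 : {measure set nat -> \bar R}) :
  (forall k, m1 [set k] = m2 [set k]) -> forall A, m1 A = m2 A.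
Proof.
move=> m12 A; have -> : A = \bigcup_(k in A) [set k].
  by apply/seteqP; split => [k Ak|k [l Al /= ->]//]; exists k.
have tA : trivIset A (fun k => [set k]) by move=> i j _ _ [x [/= -> ->]].
rewrite !measure_bigcup//.
by apply: eq_eseriesr => k _.
Qed.

Lemma series_pmf_cvg (P : probability nat R) :
  series (fun k => fine (P [set k])) @ \oo --> (1 : R).
Proof.
have PT : (\sum_(0 <= k <oo) P [set k] = 1)%E.
  rewrite -(probability_setT P).
  have -> : [set: nat] = \bigcup_k [set k] by apply/seteqP; split => // k _; exists k.
  rewrite measure_bigcup//; last by move=> i j _ _ [x [/= -> ->]].
  by apply: eq_eseriesl => k; rewrite in_setT.
have cv : (\sum_(0 <= i < k) P [set i])%E @[k --> \oo] --> (1%:E : \bar R).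
  by rewrite -PT; apply: is_cvg_nneseries => k _ _; exact: measure_ge0.
rewrite (_ : series _ = fine \o (fun k => \sum_(0 <= i < k) P [set i])%E).
  exact: fine_cvg.
apply/funext => k; rewrite /series/= -[LHS]/(fine (_)%:E) -sumEFin; congr fine.
by apply: eq_bigr => i _; rewrite fineK// fin_num_measure.
Qed.

Lemma series_finite_pmf_cvg (f : nat -> R) N :
  (forall k, (N <= k)%N -> f k = 0) -> \sum_(k < N) f k = 1 ->
  series f @ \oo --> (1 : R).
Proof.
move=> f0 f1; apply: (@cvg_near_cst _ _ _ _ \oo); exists N => // m /= Nm.
rewrite /series/= (big_cat_nat (n := N))//= big_mkord f1 big_nat big1 ?addr0//.
by move=> k /andP[/f0].
Qed.

(** For [lambda = 0] this uses [0 ^ 0 = 1]. *)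
Lemma poisson_prob_set1 (lambda : R) k : 0 <= lambda ->
  poisson_prob lambda 0 [set k] = (expR (- lambda) / k`!%:R * lambda ^+ k)%:E.
Proof.
rewrite le_eqVlt => /predU1P[<-|l0].
  rewrite /poisson_prob ltxx oppr0 expR0 diracE expr0n.
  have -> : (0%N \in [set k]) = (k == 0%N).
    by apply/idP/eqP => [/set_mem/= //|->]; exact/mem_set.
  by case: k => [|k]; rewrite ?fact0 ?divr1 ?mulr1 ?mulr0.
rewrite /poisson_prob l0 esum_set1 ?lee_fin ?poisson_pmf_ge0// /poisson_pmf l0.
by congr EFin; ring.
Qed.

End nat_pmf.

(** * The law of an infinitely divisible variable *)

Section source.
Context {R : realType} {n : nat}.

Lemma measurable_ord_preimage d (T : measurableType d) (P : probability T R)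
  (X : {RV P >-> 'I_n.+1}) (B : set 'I_n.+1) : measurable (X @^-1` B).
Proof. exact: measurable_funPTI. Qed.

Lemma sum_probability_fibers d (T : measurableType d) (P : probability T R)
  (X : {RV P >-> 'I_n.+1}) : \sum_x fine (P (X @^-1` [set x])) = 1.
Proof.
apply: EFin_inj; rewrite -sumEFin -(probability_setT P).
have := @probability_fin_preimage _ _ _ P _ X setT xpredT measurableT
  (fun z => measurable_ord_preimage X [set z]).
rewrite setTI (_ : X @^-1` _ = setT); last by apply/seteqP; split.
move=> ->; apply: eq_bigr => x _.
by rewrite setTI fineK// fin_num_measure//; exact: measurable_ord_preimage.
Qed.

Lemma infinitely_divisible_pmf d (T : measurableType d) (P : probability T R)
    (xi : {RV P >-> 'I_n.+1}) : infinitely_divisible xi ->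
  divisible_pmf (fun x => fine (P (xi @^-1` [set x]))).
Proof.
move=> xi_id m m0; have [d' [T' [Q [X [Xs [a [XsX Xsind xiE]]]]]]] := xi_id m m0.
exists (fun x => fine (Q (X @^-1` [set x]))), a; split.
- by move=> x; rewrite fine_ge0.
- exact: sum_probability_fibers.
move=> x; have -> : P (xi @^-1` [set x]) =
  Q ((fun w => \sum_(i < m) Xs i w + a) @^-1` [set x]) by exact: xiE.
have -> : (fun w => \sum_(i < m) Xs i w + a) @^-1` [set x] =
    setT `&` [set w | \sum_i Xs i w = x - a].
  rewrite setTI; apply/seteqP; split => w /=.
    by move=> <-; rewrite addrK.
  by move=> ->; rewrite subrK.
rewrite (@probability_sum_eq _ _ _ Q _ _ (fun i => Xs i) _ setT 1
  (fun x => fine (Q (X @^-1` [set x])))) ?mul1r// => [i y|s].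
  exact: measurable_ord_preimage.
rewrite setTI mul1r.
pose J : {fset 'I_m} := [fset i in index_enum 'I_m]%fset.
have Jall i : i \in J by rewrite inE mem_index_enum.
have := Xsind J (fun i => Xs i @^-1` [set s i]).
rewrite (_ : [set` J] = setT); last by apply/seteqP; split => i //= _; exact: Jall.
move=> ->; last first.
  by move=> i _; exists [set s i] => //; rewrite setTI.
rewrite (perm_big (index_enum 'I_m)); last first.
  by apply: uniq_perm; rewrite ?fset_uniq ?index_enum_uniq// => i; rewrite Jall mem_index_enum.
rewrite -prodEFin; apply: eq_bigr => i _.
have := XsX i [set s i] I; rewrite /pushforward => ->.
by rewrite fineK// fin_num_measure//; exact: measurable_ord_preimage.
Qed.

End source.

(** * Realisation of a compound Poisson variable *)

Section model.
Context {R : realType}.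

(** Mutual independence of an arbitrary family of sigma-algebras, each contained
    in the one generated by its own member of an independent sequence. *)
Lemma mutually_independent_reindex d (T : measurableType d) (Q : probability T R)
    (Y : nat -> {RV Q >-> nat}) (I : choiceType) (idx : I -> nat)
    (S : I -> set (set T)) :
  (forall m (A : nat -> set nat), Q (\bigcap_(j < m) Y j @^-1` A j) =
      (\prod_(j < m) Q (Y j @^-1` A j))%E) ->
  injective idx ->
  (forall i E, S i E -> exists B, E = Y (idx i) @^-1` B) ->
  mutually_independent Q S.
Proof.
move=> QY idx_inj SY J E SE.
have /choice[B EB] : forall i, exists B, i \in J -> E i = Y (idx i) @^-1` B.
  move=> i; case: (boolP (i \in J)) => [iJ|_]; last by exists setT.
  by have [B ->] := SY i _ (SE i iJ); exists B.
(* [A j] is [B i] if [j = idx i] with [i] in [J], and the full set otherwise. *)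
pose A j := [set y | forall i, i \in J -> idx i = j -> B i y].
have AE i : i \in J -> Y (idx i) @^-1` A (idx i) = E i.
  move=> iJ; rewrite EB//; apply/seteqP; split => w /=; first exact.
  by move=> Bw i' _ /idx_inj ->.
pose m := (\max_(i <- J) idx i)%N.+1.
have Jm i : i \in J -> (idx i < m)%N.
  by move=> iJ; rewrite ltnS; by apply: (@leq_bigmax_seq _ _ xpredT idx).
transitivity (Q (\bigcap_(j < m) Y j @^-1` A j)).
  congr (Q _); apply/seteqP; split => w /= Ew.
    by move=> j _ i iJ <-; have := Ew i iJ; rewrite EB.
  by move=> i iJ; rewrite -AE//; apply: Ew; exact: Jm.
rewrite QY -(big_mkord xpredT (fun j => Q (Y j @^-1` A j))).
transitivity (\prod_(j <- [seq j <- index_iota 0 m | j \in map idx J]) Q (Y j @^-1` A j))%E.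
  rewrite big_filter [RHS]big_mkcond; apply: eq_bigr => j _.
  case: ifPn => // jJ; rewrite (_ : A j = setT) ?preimage_setT ?probability_setT//.
  apply/seteqP; split => // y _ i iJ ij.
  by move: jJ; rewrite -ij map_f.
rewrite (perm_big (map idx J)); last first.
  apply: uniq_perm; first by rewrite filter_uniq// iota_uniq.
    by rewrite map_inj_uniq// fset_uniq.
  move=> j; rewrite mem_filter mem_index_iota; apply/andP/idP => [[]//|jJ].
  by split => //; have /mapP[i iJ ->] := jJ; rewrite Jm.
by rewrite big_map big_seq [RHS]big_seq; apply: eq_bigr => i iJ; rewrite AE.
Qed.

Variables (n M : nat) (lambda : R) (f : 'I_n.+1 -> R).
Hypotheses (M0 : (0 < M)%N) (Mn : (M %| n.+1)%N) (l0 : 0 <= lambda).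
Hypotheses (f0 : forall x, 0 <= f x) (f1 : \sum_x f x = 1).
Local Notation D := (n.+1 %/ M)%N.

(** The laws on the natural numbers of the independent sequence to be built:
    the uniform law for [U], the Poisson law for [V], and then, for each [X_k],
    the law [f] carried over to the representatives [0, ..., n]. *)
Definition model_pmf (j k : nat) : R :=
  match j with
  | 0 => if (k < D)%N then D%:R^-1 else 0
  | 1 => fine (poisson_prob lambda 0 [set k])
  | _ => if (k < n.+1)%N then f (inZp k) else 0
  end.

Let D0 : (0 < D)%N.
Proof. by rewrite divn_gt0// dvdn_leq. Qed.

Lemma model_pmf_ge0 j k : 0 <= model_pmf j k.
Proof.
by case: j => [|[|j]] /=; [case: ifP|exact: fine_ge0|case: ifP].
Qed.

Lemma model_pmf_cvg j : series (model_pmf j) @ \oo --> (1 : R).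
Proof.
case: j => [|[|j]].
- apply: (@series_finite_pmf_cvg _ _ D) => [k|].
    by rewrite leqNgt /= => /negPf ->.
  under eq_bigr do rewrite /= ltn_ord.
  by rewrite sumr_const card_ord -[LHS]mulr_natl divff// pnatr_eq0 -lt0n.
- exact: (series_pmf_cvg (poisson_prob lambda 0)).
apply: (@series_finite_pmf_cvg _ _ n.+1) => [k|].
  by rewrite leqNgt /= => /negPf ->.
by rewrite -f1; apply: eq_bigr => i _; rewrite /= ltn_ord inZp_val.
Qed.

(** The law of [Z] is obtained by conditioning on the values [k] of [V] and [u]
    of [U]. *)
Lemma compound_poisson_model (a : 'I_n.+1) :
  exists (d : measure_display) (T : measurableType d) (Q : probability T R)
    (X : {RV Q >-> 'I_n.+1}) (U V : {RV Q >-> nat})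
    (Xs : nat -> {RV Q >-> 'I_n.+1}),
    [/\ uniformly_distributed Q D U, poisson_distributed Q lambda V,
        forall k, eq_in_distribution Q (Xs k) Q X,
        mutually_independent Q (joint_family U V Xs) &
        let Z w := a + inZp (M * U w)%N + \sum_(k < V w) Xs k w in
        forall x, measurable (Z @^-1` [set x]) /\
        Q (Z @^-1` [set x]) = (\sum_(0 <= k <oo)
          (expR (- lambda) / k`!%:R * lambda ^+ k * (D%:R^-1 *
             \sum_(u < D) (circulant f ^+ k) (x - a - inZp (M * u)%N) 0))%:E)%E].
Proof.
have [d [T [Q [Y [Y1 Yind]]]]] := independent_sequence model_pmf_ge0 model_pmf_cvg.
have mX k : measurable_fun setT (fun w => inZp (Y k.+2 w) : 'I_n.+1).
  exact: (measurableT_comp (f := inZp : nat -> 'I_n.+1)).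
pose Xs k : {RV Q >-> 'I_n.+1} :=
  HB.pack (fun w => inZp (Y k.+2 w) : 'I_n.+1) (isMeasurableFun.Build _ _ _ _ _ (mX k)).
have QXs k x : Q (Xs k @^-1` [set x]) = (f x)%:E.
  rewrite (@probability_partition _ _ _ Q _ (fun i : 'I_n.+1 => Y k.+2 @^-1` [set val i])).
  - rewrite (bigD1 x)//= big1 ?adde0 => [|i ix].
      rewrite (_ : _ `&` _ = Y k.+2 @^-1` [set val x]).
        by rewrite Y1 /= ltn_ord inZp_val.
      apply/seteqP; split => [w []//|w /= wx]; split => //=.
      by rewrite wx inZp_val.
    rewrite (_ : _ `&` _ = set0) ?measure0//.
    by apply/seteqP; split => // w /= [+ wi]; rewrite wi inZp_val; exact/eqP.
  - by move=> i; exact: measurable_funPTI.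
  - by move=> i j _ _ [w [/= wi wj]]; apply: val_inj; rewrite /= -wi -wj.
  - under eq_bigr do rewrite Y1 /= ltn_ord inZp_val.
    by rewrite sumEFin f1.
  - exact: measurable_ord_preimage.
exists d, T, Q, (Xs 0%N), (Y 0%N), (Y 1%N), Xs; split.
- by move=> u; rewrite /pushforward Y1 /=; case: ifP.
- move=> A; apply: (eq_measure_nat (m1 := distribution Q (Y 1%N))
    (m2 := poisson_prob lambda 0)) => k.
  transitivity (model_pmf 1 k)%:E; first exact: Y1.
  by rewrite /= fineK// fin_num_measure.
- move=> k A _; rewrite /pushforward.
  have QXsA j : Q (Xs j @^-1` A) = (\sum_(x | x \in A) (f x)%:E)%E.
    have := @probability_fin_preimage _ _ _ Q _ (Xs j) setT (fun x => x \in A)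
      measurableT (fun x => measurable_ord_preimage (Xs j) [set x]).
    rewrite setTI (_ : [set _ | _] = A) => [->|].
      by apply: eq_bigr => x _; rewrite setTI QXs.
    by apply/seteqP; split => x /=; [move/set_mem|move/mem_set].
  by rewrite !QXsA.
- pose idx (i : option (option nat)) := if i is Some i' then
     if i' is Some k then k.+2 else 1%N else 0%N.
  apply: (mutually_independent_reindex (idx := idx) Yind).
    by case=> [[k|]|] [[l|]|] //= [->].
  case=> [[k|]|] E /= [B _ <-]; [exists (inZp @^-1` B)|exists B|exists B];
    by rewrite setTI.
move=> Z x.
(* [E k] is the event [Z = x] and [V = k]; on [E k] with [U = u] the sum of the
   first [k] variables has the prescribed value defining [S k u]. *)
pose E k := Z @^-1` [set x] `&` Y 1%N @^-1` [set k].
pose S k u := [set w | \sum_(i < k) Xs i w = x - a - inZp (M * u)%N].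
have mY j y : measurable (Y j @^-1` [set y]) by exact: measurable_funPTI.
have mS k u : measurable (S k u).
  by apply: (measurable_sum_eq (Z := fun i : 'I_k => Xs i)) => i y;
    exact: measurable_ord_preimage.
have EE k u : E k `&` Y 0%N @^-1` [set u] =
    (Y 0%N @^-1` [set u] `&` Y 1%N @^-1` [set k]) `&` S k u.
  apply/seteqP; split => w /=.
    move=> [[Zx Vk] Uu]; split => //; rewrite /S /= -Vk -Uu -Zx /Z.
    by rewrite -[RHS]addrA -opprD [a + _ + _]addrC addrK.
  move=> [[Uu Vk] Sx]; split => //; split => //.
  rewrite /Z /= Vk Uu Sx.
  by rewrite -[x - a - _]addrA -opprD [LHS]addrC subrK.
have mE k : measurable (E k).
  have -> : E k = \bigcup_u (E k `&` Y 0%N @^-1` [set u]).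
    by apply/seteqP; split => [w Ew|w [u _ []]//]; exists (Y 0%N w).
  by apply: bigcupT_measurable => u; rewrite EE; do 2 apply: measurableI => //.
have ZE : Z @^-1` [set x] = \bigcup_k E k.
  by apply/seteqP; split => [w Zw|w [k _ []]//]; exists (Y 1%N w).
split; first by rewrite ZE; exact: bigcupT_measurable.
rewrite ZE measure_bigcup//; last first.
  by move=> i j _ _ [w [[_ /= <-] [_ /= <-]]].
rewrite (eq_eseriesl (Q := xpredT)); last by move=> k; rewrite in_setT.
apply: eq_eseriesr => k _.
transitivity (\sum_(u < D) Q (E k `&` Y 0%N @^-1` [set val u]))%E.
  apply: probability_partition => //.
    by move=> i j _ _ [w [/= wi wj]]; apply: val_inj; rewrite /= -wi -wj.
  under eq_bigr do rewrite Y1 /= ltn_ord.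
  by rewrite sumEFin sumr_const card_ord -[X in X%:E]mulr_natl divff// pnatr_eq0 -lt0n.
rewrite !mulr_sumr -sumEFin; apply: eq_bigr => u _.
  rewrite EE; pose c := D%:R^-1 * (expR (- lambda) / k`!%:R * lambda ^+ k).
  rewrite (@probability_sum_eq _ _ _ Q _ _ (fun i : 'I_k => Xs i) _ _ c f).
  + by congr EFin; rewrite /c; ring.
  + by move=> i y; exact: measurable_ord_preimage.
  + by apply: measurableI.
  move=> s; pose A j : set nat := match j with
    | 0 => [set val u] | 1 => [set k]
    | j.+2 => [set y | forall i : 'I_k, val i = j -> inZp y = s i] end.
  have AE (i : 'I_k) : Y i.+2 @^-1` A i.+2 = Xs i @^-1` [set s i].
    apply/seteqP; split => w /=; first exact.
    by move=> ws i' /val_inj ->.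
  transitivity (Q (\bigcap_(j < k.+2) Y j @^-1` A j)).
    congr (Q _); apply/seteqP; split => w /=.
      move=> [[wu wk] ws] [|[|j]]//= jk i ij.
      by have := ws i Logic.I; rewrite /= ij.
    move=> wA; split; first by split; [exact: (wA 0%N)|exact: (wA 1%N)].
    by move=> i _; rewrite -AE; apply: (wA i.+2); rewrite /= !ltnS.
  rewrite Yind !big_ord_recl /= !Y1 /= ltn_ord.
  rewrite fineK ?fin_num_measure// poisson_prob_set1// muleA -EFinM -/c.
  rewrite [RHS]EFinM -prodEFin; congr (_ * _)%E; apply: eq_bigr => i _.
  by rewrite -(QXs i) -AE.
Qed.

End model.

(** * Identification of the law *)

Section comparison.
Context {R : realType}.

(** A law on a finite set that is pointwise below another one equals it, since
    both have total mass 1. *)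
Lemma eq_probability_of_le (I : finType) d1 d2 (T1 : measurableType d1)
    (T2 : measurableType d2) (P : probability T1 R) (Q : probability T2 R)
    (X : T1 -> I) (Y : T2 -> I) :
  (forall x, measurable (X @^-1` [set x])) ->
  (forall x, measurable (Y @^-1` [set x])) ->
  (forall x, (Q (Y @^-1` [set x]) <= P (X @^-1` [set x]))%E) ->
  forall A, P (X @^-1` A) = Q (Y @^-1` A).
Proof.
move=> mX mY QP.
have sumE d (T : measurableType d) (m : probability T R) (Z : T -> I) (A : set I) :
    (forall x, measurable (Z @^-1` [set x])) ->
    m (Z @^-1` A) = (\sum_(x | x \in A) m (Z @^-1` [set x]))%E.
  move=> mZ; transitivity (m (setT `&` Z @^-1` [set z | z \in A])).
    by congr (m _); rewrite setTI; apply/seteqP; split => w /=; [move/mem_set|move/set_mem].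
  by rewrite probability_fin_preimage//; apply: eq_bigr => x _; rewrite setTI.
have QP_le A : (Q (Y @^-1` A) <= P (X @^-1` A))%E.
  by rewrite !sumE//; apply: lee_sum => x _.
have compl d (T : measurableType d) (m : probability T R) (Z : T -> I) (A : set I) :
    (forall x, measurable (Z @^-1` [set x])) ->
    m (Z @^-1` ~` A) = (1 - fine (m (Z @^-1` A)))%:E.
  move=> mZ; have mA : measurable (Z @^-1` A) by exact: measurable_fin_preimage.
  by rewrite EFinB fineK ?fin_num_measure//; exact: (probability_setC m mA).
move=> A; apply/eqP; rewrite eq_le QP_le andbT.
have := QP_le (~` A); rewrite (compl _ _ P)// (compl _ _ Q)// lee_fin lerD2l lerN2.
by rewrite -lee_fin !fineK// fin_num_measure//; exact: measurable_fin_preimage.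
Qed.

End comparison.

Theorem theorem6 (R : realType) (n : nat) (d : measure_display)
    (T : measurableType d) (P : probability T R) (xi : {RV P >-> 'I_n.+1}) :
  infinitely_divisible xi ->
  exists (a : 'I_n.+1) (M : nat) (lambda : R)
    (d' : measure_display) (T' : measurableType d') (Q : probability T' R)
    (X : {RV Q >-> 'I_n.+1})
    (U V : {RV Q >-> nat}) (Xs : nat -> {RV Q >-> 'I_n.+1}),
    [/\ (M %| n.+1)%N, 0 <= lambda &
        uniformly_distributed Q (n.+1 %/ M) U] /\
    [/\ poisson_distributed Q lambda V,
        forall k, eq_in_distribution Q (Xs k) Q X,
        mutually_independent Q (joint_family U V Xs) &
        eq_in_distribution P xi Q
          (fun w => a + inZp (M * U w) + \sum_(k < V w) Xs k w)].
Proof.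
move=> /infinitely_divisible_pmf/divisible_pmf_lower_bound[a [M [nu [M0 Mn nu0 nuP]]]].
set lambda := \sum_y nu y in nuP.
have l0 : 0 <= lambda by apply: sumr_ge0.
(* [f] is [nu] normalised; for [nu = 0] any law will do, here the Dirac mass at
   the origin. *)
pose f (x : 'I_n.+1) : R := if lambda == 0 then (x == 0)%:R else nu x / lambda.
have f0 x : 0 <= f x by rewrite /f; case: ifP => _; rewrite ?ler0n ?divr_ge0.
have f1 : \sum_x f x = 1.
  rewrite /f; have [_|l_neq0] := eqVneq lambda 0; last by rewrite -mulr_suml divff.
  by rewrite (bigD1 0)//= big1 ?addr0// => x /negPf ->.
have nuE : nu = fun x => lambda * f x.
  apply/funext => x; rewrite /f; case: eqP => [l_eq0|/eqP l_neq0]; last by rewrite mulrC divfK.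
  rewrite l_eq0 mul0r; move: l_eq0 => /eqP; rewrite /lambda psumr_eq0// => /allP/(_ x).
  by rewrite mem_index_enum => /(_ isT)/eqP.
have nuX k y : (circulant nu ^+ k) y 0 = lambda ^+ k * (circulant f ^+ k) y 0.
  have -> : circulant nu = lambda *: circulant f.
    by apply/matrixP => i j; rewrite !mxE nuE.
  by rewrite exprZn mxE.
have [d' [T' [Q [X [U [V [Xs [UD Vl XsX ind ZP]]]]]]]] :=
  compound_poisson_model M0 Mn l0 f0 f1 a.
exists a, M, lambda, d', T', Q, X, U, V, Xs; split=> //; split=> // A _.
apply: eq_probability_of_le => [x|x|x].
- exact: measurable_ord_preimage.
- exact: (ZP x).1.
rewrite (ZP x).2 -[leRHS]fineK ?fin_num_measure//; last exact: measurable_ord_preimage.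
apply: lime_le.
  apply: is_cvg_nneseries => k _ _; rewrite lee_fin !mulr_ge0 ?expR_ge0 ?invr_ge0 ?exprn_ge0//.
  by apply: sumr_ge0 => u _; exact: circulantX_ge0.
apply: nearW => K; rewrite sumEFin lee_fin big_mkord.
apply: le_trans (nuP K x); rewrite le_eqVlt; apply/orP; left; apply/eqP.
apply: eq_bigr => k _; rewrite -mulrA; congr (_ * _).
rewrite mulrCA; congr (_ * _); rewrite mulr_sumr.
by apply: eq_bigr => u _; rewrite nuX.
Qed.
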